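(* Consider a $2$-step walk of turning angle $\pi/2$ of even length $L$ (total number of unit steps) from the origin to $k+i\ell$ (with $k+\ell$ even). Its defining polynomial is given by $$p(x)=(x+1)(x-1)\left(-\frac{\ell}{2}x-\frac{k}{2}\right)+\frac{L}{4}(x+1)(x^2+1).$$ In particular the defining polynomial is uniquely determined by the length and the end point of the walk, and as a consequence the (unordered) steps used to complete the walk are also uniquely determined by the length and the end point.
   Context: A *$2$-step walk with turning angle $\pi/2$* is a walk in $\mathbb{C}\cong\mathbb{R}^2$ starting at the origin, with an even number $L$ of unit steps (taken two at a time), whose successive increments are $i^{s_0},i^{s_1},\ldots,i^{s_{L-1}}$ with $s_j\in\mathbb{Z}/4\mathbb{Z}$ and $s_{j}=s_{j-1}\pm1$ in $\mathbb{Z}/4\mathbb{Z}$ for $1\le j\le L-1$ (at each step one turns left or right through $\pi/2$); the first direction $s_0$ is arbitrary, and the walk need not be closed. Its *defining polynomial* is $p(x)=b_3x^3+b_2x^2+b_1x+b_0$, where $b_k$ is the number of increments equal to $i^k$. *)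

(* Defs.v *)
From mathcomp Require Export all_boot all_order all_algebra.
From mathcomp Require Export reals.
From mathcomp Require Export complex.
Set Implicit Arguments.
Unset Strict Implicit.
Unset Printing Implicit Defensive.
Import Order.TTheory GRing.Theory Num.Theory.
Local Open Scope ring_scope.

(* A walk from the origin is encoded by its list of directions
   s_0, ..., s_(L-1); the j-th increment is then i^(s_j). *)
Definition is_turn (a b : 'Z_4) : bool := (b == a + 1) || (b == a - 1).

Definition two_step_walk (L : nat) (s : seq 'Z_4) : bool :=
  [&& size s == L, ~~ odd L & sorted is_turn s].

(* The exponent is the representative of a in {0, 1, 2, 3}. *)
Definition increments (R : realType) (s : seq 'Z_4) : seq R[i] :=
  [seq 'i ^+ a | a : 'Z_4 <- s].

Definition endpoint (R : realType) (s : seq 'Z_4) : R[i] :=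
  \sum_(z <- increments R s) z.

Definition step_count (R : realType) (s : seq 'Z_4) (k : nat) : nat :=
  count_mem ('i ^+ k) (increments R s).

(* Rational coefficients, because L / 4, k / 2 and l / 2 need not be
   integers. *)
Definition defining_poly (R : realType) (s : seq 'Z_4) : {poly rat} :=
  let b (k : nat) : rat := (step_count R s k)%:R in
  b 3 *: 'X^3 + b 2 *: 'X^2 + b 1 *: 'X + (b 0)%:P.

(* Main.v *)
Require Import Defs.
From mathcomp Require Import zify ring lra.
Set Implicit Arguments.
Unset Strict Implicit.
Unset Printing Implicit Defensive.
Import Order.TTheory GRing.Theory Num.Theory.
Local Open Scope ring_scope.

(** The numbers [c0, c1, c2, c3] of steps in the four directions satisfy four
    independent linear equations. Turning through a right angle alternates
    horizontal and vertical steps, so a walk of even length [L] has exactly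
    [L / 2] of each kind: [c0 + c2 = c1 + c3 = L / 2]
    ([count_alternating]). Opposite steps cancel, so the end point is
    [(c0 - c2) + 'i (c1 - c3)] ([endpoint_rect]), and the real and imaginary
    parts [k] and [l] give [c0 - c2 = k] and [c1 - c3 = l]. Solving,
      [c0, c2 = L / 4 +- k / 2]   and   [c1, c3 = L / 4 +- l / 2],
    which is [count_direction]. The formula for the defining polynomial is
    this solution read off coefficient by coefficient. Since the solution
    depends on [L], [k] and [l] only, two walks with the same length and the
    same end point have the same multiset of directions, hence the same
    increments and the same polynomial. *)

Lemma Z4_cases (P : 'Z_4 -> Prop) : P 0 -> P 1 -> P 2 -> P 3 -> forall a, P a.
Proof.
move=> P0 P1 P2 P3 [[|[|[|[|m]]]] lt_m4] //.
- by congr P: P0; apply: val_inj.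
- by congr P: P1; apply: val_inj.
- by congr P: P2; apply: val_inj.
- by congr P: P3; apply: val_inj.
Qed.

(** The predicate [p] holds at exactly one of any two consecutive entries, so
    grouping the entries in consecutive pairs counts half of them. *)
Lemma count_alternating (T : Type) (r : rel T) (p : pred T) (s : seq T) :
  (forall a b, r a b -> p b = ~~ p a) ->
  sorted r s -> ~~ odd (size s) -> (2 * count p s = size s)%N.
Proof.
move=> alt; have [n] := ubnP (size s); elim: n s => // n IHn [|a [|b s]] //=.
rewrite negbK => lt_s /andP[/alt pb /path_sorted s_sorted] s_even.
have := IHn s (ltnW lt_s) s_sorted s_even.
by rewrite pb; case: (p a) => /=; lia.
Qed.

(** A turn changes the direction by an odd amount, and the modulus 4 is even;
    odd directions are the vertical ones. *)
Lemma odd_is_turn (a b : 'Z_4) : is_turn a b -> odd b = ~~ odd a.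
Proof. by move: a b; do 2!elim/Z4_cases. Qed.

Lemma prim4_imaginary (C : numClosedFieldType) : 4.-primitive_root ('i : C).
Proof.
have i4 : 'i ^+ 4 = 1 :> C by rewrite (exprM _ 2 2) sqrCi sqrrN expr1n.
have [m i_prim m_dvd4] := prim_order_exists (isT : (0 < 4)%N) i4.
(* A divisor of 4 that does not divide 2 is 4, and ['i ^+ 2 = -1 != 1]. *)
suff m_ndvd2 : ~~ (m %| 2)%N.
  have : (m <= 4)%N by apply: dvdn_leq m_dvd4.
  by case: m m_dvd4 m_ndvd2 i_prim => [|[|[|[|[|m]]]]].
rewrite (prim_order_dvd i_prim) sqrCi eq_sym -subr_eq0 opprK.
by rewrite -(natrD _ 1 1) pnatr_eq0.
Qed.

(** The polynomial counts complex increments. Since ['i] has order exactly 4,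
    distinct directions give distinct increments, and it is enough to count
    directions. *)
Lemma step_countE (R : realType) (s : seq 'Z_4) (a : 'Z_4) :
  step_count R s a = count_mem a s.
Proof.
rewrite /step_count /increments count_map; apply: eq_count => b /=.
rewrite (eq_prim_root_expr (prim4_imaginary _)) !modn_small //.
all: exact: ltn_ord.
Qed.

Lemma endpoint_rect (R : realType) (s : seq 'Z_4) :
  let c (a : 'Z_4) : int := count_mem a s in
  endpoint R s = (c 0 - c 2)%:~R + 'i * (c 1 - c 3)%:~R.
Proof.
rewrite /endpoint /increments big_map /=.
elim: s => [|a s IHs]; first by rewrite big_nil mulr0 addr0.
rewrite big_cons {}IHs /= !PoszD !(rmorphB, rmorphD) /=.
elim/Z4_cases: a => /=; rewrite ?expr0 ?expr1 ?sqrCi ?(exprS _ 2) ?sqrCi; ring.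
Qed.

Lemma int_rect_inj (C : numClosedFieldType) (k l k' l' : int) :
  k%:~R + 'i * l%:~R = k'%:~R + 'i * l'%:~R :> C -> k = k' /\ l = l'.
Proof.
move=> eq_z; split; apply: (@intr_inj C).
- by have := congr1 (fun z => 'Re z) eq_z; rewrite !Re_rect ?realz.
- by have := congr1 (fun z => 'Im z) eq_z; rewrite !Im_rect ?realz.
Qed.

(** The four equations determine the counts: half the length plus or minus the
    relevant coordinate of the end point is twice the count. Clearing the
    denominators keeps everything in the integers, where equality of counts for
    two walks can be deduced by cancelling 4. *)
Lemma count_direction (R : realType) (L : nat) (k l : int) (s : seq 'Z_4) :
  two_step_walk L s -> endpoint R s = k%:~R + 'i * l%:~R ->
  forall a : 'Z_4,
    4 * (count_mem a s)%:Z = L%:Z + 2 * [:: k; l; - k; - l]`_a.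
Proof.
case/and3P=> /eqP size_s L_even s_turns.
rewrite endpoint_rect => /int_rect_inj[].
pose c (a : 'Z_4) := count_mem a s.
rewrite -/(c 0) -/(c 1) -/(c 2) -/(c 3) => k_eq l_eq a; rewrite -/(c a).
rewrite -size_s in L_even *.
have vertical := count_alternating odd_is_turn s_turns L_even.
have odd_count : count (fun b : 'Z_4 => odd b) s = (c 1%R + c 3%R)%N.
  by rewrite /c; elim: (s) => //= b s' ->; elim/Z4_cases: b => /=; lia.
have size_count : size s = (c 0%R + c 1%R + c 2%R + c 3%R)%N.
  by rewrite /c; elim: (s) => //= b s' ->; elim/Z4_cases: b => /=; lia.
(* Once [c] is opaque, this is linear arithmetic in its four values. *)
by elim/Z4_cases: a; clearbody c => /=; lia.
Qed.

Lemma defining_polyE (R : realType) (L : nat) (k l : int) (s : seq 'Z_4) :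
  two_step_walk L s -> endpoint R s = k%:~R + 'i * l%:~R ->
  defining_poly R s =
    ('X + 1) * ('X - 1) * ((- (l%:Q / 2)) *: 'X - (k%:Q / 2)%:P)
    + (L%:Q / 4) *: (('X + 1) * ('X^2 + 1)).
Proof.
move=> s_walk s_end.
have coef (a : 'Z_4) : (step_count R s a)%:R
    = L%:Q / 4 + ([:: k; l; - k; - l]`_a)%:Q / 2.
  have := congr1 (fun z : int => z%:Q) (count_direction s_walk s_end a).
  rewrite -(step_countE R) rmorphD !rmorphM /= -!pmulrn; lra.
have := (coef 0, coef 1, coef 2, coef 3) => /= -[[[b0 b1] b2] b3].
rewrite /defining_poly b0 b1 b2 b3 -!mul_polyC !(rmorphN, rmorphD, rmorphM) /=.
ring.
Qed.

Lemma perm_directions (R : realType) (L : nat) (s t : seq 'Z_4) :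
  two_step_walk L s -> two_step_walk L t -> endpoint R s = endpoint R t ->
  perm_eq s t.
Proof.
move=> s_walk t_walk eq_end; apply/allP => a _ /=; apply/eqP.
have t_end := endpoint_rect R t; have s_end := etrans eq_end t_end.
have := count_direction s_walk s_end a.
by rewrite -(count_direction t_walk t_end a) => /(mulfI (isT : 4 != 0 :> int))[].
Qed.

Theorem theorem20 (R : realType) :
  [/\ forall (L : nat) (k l : int) (s : seq 'Z_4),
        two_step_walk L s ->
        (2 %| k + l)%Z ->
        endpoint R s = k%:~R + 'i * l%:~R ->
        defining_poly R s =
          ('X + 1) * ('X - 1) * ((- (l%:Q / 2)) *: 'X - (k%:Q / 2)%:P)
          + (L%:Q / 4) *: (('X + 1) * ('X^2 + 1)),
      forall (L : nat) (s t : seq 'Z_4),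
        two_step_walk L s -> two_step_walk L t ->
        endpoint R s = endpoint R t ->
        defining_poly R s = defining_poly R t
    & forall (L : nat) (s t : seq 'Z_4),
        two_step_walk L s -> two_step_walk L t ->
        endpoint R s = endpoint R t ->
        perm_eq (increments R s) (increments R t)].
Proof.
split=> [L k l s s_walk _|L s t s_walk t_walk eq_end|L s t s_walk t_walk eq_end].
- exact: defining_polyE.
- have t_end := endpoint_rect R t; have s_end := etrans eq_end t_end.
  by rewrite (defining_polyE s_walk s_end) (defining_polyE t_walk t_end).
- exact/perm_map/(perm_directions s_walk t_walk eq_end).
Qed.
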